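(* Let $3\le m\le n$ be integers and let $K_{m,n}$ be the complete bipartite graph with bipartition $(A,B)$, $|A|=m$, $|B|=n$. Then the visibility polynomial of $K_{m,n}$ is $\mathcal{V}(K_{m,n})=\sum_{i=0}^{m+n-2} r_i x^i$, where $$r_i=\begin{cases}\binom{m+n}{i} & \text{if } 0\le i\le m+1,\\[6pt] \binom{m+n}{i}-\binom{n}{i-m} & \text{if } m+2\le i\le n+1,\\[6pt] \binom{m+n}{i}-\binom{n}{i-m}-\binom{m}{i-n} & \text{if } n+2\le i\le m+n-2.\end{cases}$$
   Context: Graphs are finite, simple and undirected. For a graph $G=(V,E)$ and $X\subseteq V$, two vertices $u,v$ are $X$-visible if there is a shortest $(u,v)$-path $P$ in $G$ with $V(P)\cap X\subseteq\{u,v\}$. A set $X\subseteq V$ is a mutual-visibility set of $G$ if every pair of vertices in $X$ is $X$-visible (the empty set counts as a mutual-visibility set). The visibility polynomial of $G$ is $\mathcal{V}(G)=\sum_{i\ge 0} r_i x^i$, where $r_i$ is the number of mutual-visibility sets of $G$ of cardinality $i$. Cases whose range of $i$ is empty are vacuous. *)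

(* Defs.v *)
From mathcomp Require Import all_boot all_order all_algebra.
From mathcomp Require Import boolp.

Set Implicit Arguments.
Unset Strict Implicit.
Unset Printing Implicit Defensive.

Import GRing.Theory.
Local Open Scope ring_scope.

Record sgraph := SGraph {
  svertex :> finType;
  sedge : rel svertex;
  sedge_sym : symmetric sedge;
  sedge_irr : irreflexive sedge }.

Section Visibility.
Variable G : sgraph.
Implicit Types (u v : G) (p q : seq G) (X : {set G}).

(* The path has vertex sequence u :: p, so that its length is size p. *)
Definition is_path u v p : Prop :=
  [/\ path (@sedge G) u p, uniq (u :: p) & last u p = v].

Definition is_shortest_path u v p : Prop :=
  is_path u v p /\ (forall q, is_path u v q -> (size p <= size q)%N).

Definition visible X u v : Prop :=
  exists2 p, is_shortest_path u v p &
    forall w, w \in u :: p -> w \in X -> w = u \/ w = v.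

Definition mutual_visibility X : Prop :=
  forall u v, u \in X -> v \in X -> visible X u v.

Definition num_mutual_visibility (i : nat) : nat :=
  #|[set X : {set G} | `[< mutual_visibility X >] & #|X| == i]|.

(* No set of vertices has more than #|G| elements, so the sum over all i >= 0
   stops at #|G|. *)
Definition visibility_poly : {poly int} :=
  \sum_(0 <= i < #|G|.+1) (num_mutual_visibility i)%:Z *: 'X^i.

End Visibility.

Definition Kedge (m n : nat) : rel ('I_m + 'I_n)%type :=
  fun x y => match x, y with
             | inl _, inr _ | inr _, inl _ => true
             | _, _ => false
             end.

Lemma Kedge_sym m n : symmetric (@Kedge m n).
Proof. by case=> [a|b] [a'|b']. Qed.

Lemma Kedge_irr m n : irreflexive (@Kedge m n).
Proof. by case. Qed.

Definition complete_bipartite (m n : nat) : sgraph :=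
  SGraph (@Kedge_sym m n) (@Kedge_irr m n).

(* Main.v *)
Require Import Defs.
From mathcomp Require Import all_boot all_order all_algebra.
From mathcomp Require Import boolp zify.

(** The mutual-visibility sets of a complete bipartite graph can be read off
    from cardinalities.  Two vertices on different sides are adjacent, so they
    see each other whatever X is.  Two distinct vertices u, v on the same side
    are at distance 2, and the inner vertex of a shortest path between them can
    be any vertex of the opposite side; hence they fail to be X-visible exactly
    when X contains that whole opposite side.  So X fails to be a
    mutual-visibility set if and only if it contains one side S together with
    at least two more vertices (lemma [mutual_visibilityP]).

    The sets of cardinality i are therefore split into the mutual-visibility
    sets and, for each side S with #|S| + 2 <= i, the supersets of S of
    cardinality i, which are counted by choosing their i - #|S| elements
    outside S ([card_supersets]).  A set that contains both sides is the whole
    vertex set, so the two families of bad sets overlap only when i = m + n,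
    and then in one set: inclusion-exclusion gives [num_mutual_visibilityE],
    valid for every i.  The three cases of the formula record which of the two
    families are nonempty, and the coefficients of degrees m + n - 1 and m + n
    vanish because every set that large is bad. *)

Set Implicit Arguments.
Unset Strict Implicit.
Unset Printing Implicit Defensive.

Import GRing.Theory.
Local Open Scope ring_scope.

(** * Supersets of a fixed set *)

(** Removing S is a bijection onto the subsets of the complement of S. *)
Lemma card_supersets (T : finType) (S : {set T}) (i : nat) :
  (#|S| <= i)%N ->
  #|[set X : {set T} | (S \subset X) && (#|X| == i)]| = 'C(#|~: S|, i - #|S|).
Proof.
move=> leSi; rewrite -cards_draws.
have injD : {in [set X : {set T} | (S \subset X) && (#|X| == i)] &,
             injective (fun X => X :\: S)}.
  move=> X Y; rewrite !inE => /andP[SX _] /andP[SY _] eqXY.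
  by rewrite -(setID X S) -(setID Y S) eqXY (setIidPr SX) (setIidPr SY).
rewrite -(card_in_imset injD); apply: eq_card => Z; rewrite !inE.
apply/imsetP/andP => [[X] | [ZS /eqP cardZ]].
  rewrite inE => /andP[SX /eqP cardX] ->.
  by rewrite setDE subsetIr -setDE cardsDS // cardX.
have SZ0 : Z :&: S = set0.
  by apply/eqP; rewrite setI_eq0 -(setCK S) -subsets_disjoint.
exists (Z :|: S); last first.
  by rewrite setDUl setDv setU0; apply/esym/setDidPl; rewrite -setI_eq0 SZ0.
by rewrite inE subsetUr cardsU SZ0 cards0 subn0 cardZ subnK /=.
Qed.

(** * Visibility along paths of length at most two *)

Section Visible.
Variable G : sgraph.
Implicit Types (u v w : G) (X : {set G}).

Lemma visible_refl X u : visible X u u.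
Proof. by exists [::] => // w; rewrite inE => /eqP; left. Qed.

Lemma visible_adjacent X u v : sedge u v -> visible X u v.
Proof.
move=> uv; have neq_uv : u != v by apply: contraTneq uv => ->; rewrite sedge_irr.
exists [:: v] => [|w]; last by rewrite !inE => /orP[]/eqP; [left | right].
split=> [|[|w q] [_ _ /= lastq] //]; first by split; rewrite /= ?uv ?inE ?neq_uv.
by rewrite -lastq eqxx in neq_uv.
Qed.

Lemma visible_through X u v w :
  ~~ sedge u v -> u != v -> sedge u w -> sedge w v -> w \notin X ->
  visible X u v.
Proof.
move=> uv neq_uv uw wv wX.
have neq_uw : u != w by apply: contraTneq uw => ->; rewrite sedge_irr.
have neq_wv : w != v by apply: contraTneq wv => ->; rewrite sedge_irr.
exists [:: w; v] => [|z]; last first.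
  rewrite !inE => /or3P[]/eqP -> //; [by left | by rewrite (negPf wX) | by right].
split=> [|[|z [|z' q]] [/= pathq _ lastq] //].
- by split; rewrite /= ?uw ?wv // !inE negb_or neq_uw neq_uv neq_wv.
- by rewrite -lastq eqxx in neq_uv.
- by rewrite lastq (negPf uv) in pathq.
Qed.

End Visible.

(** * Visibility in complete bipartite graphs *)

Section CompleteBipartite.
Variables m n : nat.
Local Notation K := (complete_bipartite m n).
Implicit Types (u v w : K) (X : {set K}) (s : bool).

(** Indexing the two sides by a boolean makes adjacency a disequality and lets
    both sides be treated at once. *)
Definition side s : {set K} := [set w : K | is_inl w == s].

Lemma sedge_side u v : sedge u v = (is_inl u != is_inl v).
Proof. by case: u v => [?|?] [?|?]. Qed.

Lemma side_setC s : ~: side s = side (~~ s).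
Proof. by apply/setP => w; rewrite !inE; case: (is_inl w) s => [] []. Qed.

Lemma card_side s : #|side s| = if s then m else n.
Proof.
have imE : side s = if s then inl @: [set: 'I_m] else inr @: [set: 'I_n].
  case: s; apply/setP => -[a|b]; rewrite inE /=; apply/esym.
  - exact: imset_f.
  - by apply/negP => /imsetP[].
  - by apply/negP => /imsetP[].
  - exact: imset_f.
rewrite imE; case: s {imE}; rewrite card_imset ?cardsT ?card_ord //.
  by move=> a b [].
by move=> a b [].
Qed.

Lemma card_vertices : #|K| = (m + n)%N.
Proof. by rewrite -(cardsC (side true)) side_setC !card_side. Qed.

(** The second vertex of a path between two distinct vertices of one side lies
    on the other side, so it is an inner vertex and avoids X. *)
Lemma visible_same_side X u v s :
  u \in side s -> v \in side s -> u != v -> visible X u v ->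
  ~~ (side (~~ s) \subset X).
Proof.
rewrite !inE => /eqP us /eqP vs neq_uv [p [[pathp _ lastp] _] innerp].
case: p => [|w p] in pathp lastp innerp *; first by rewrite -lastp eqxx in neq_uv.
case/andP: pathp; rewrite sedge_side us => neq_sw _.
apply/subsetPn; exists w; first by rewrite inE; case: (is_inl w) s neq_sw {us vs}
  => [] [].
apply/negP => wX; have [|eq_w|eq_w] := innerp w _ wX.
- by rewrite !inE eqxx orbT.
- by rewrite eq_w us eqxx in neq_sw.
- by rewrite eq_w vs eqxx in neq_sw.
Qed.

Lemma mutual_visibilityP X :
  mutual_visibility X <->
  forall s, side s \subset X -> (#|X| <= #|side s| + 1)%N.
Proof.
split=> [visX s sX | smallX u v uX vX].
  rewrite leqNgt; apply/negP => ltX.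
  (* X has two vertices outside side s, which side s separates. *)
  have /card_gt1P[u [v [uD vD neq_uv]]] : (1 < #|X :\: side s|)%N.
    by rewrite cardsDS //; lia.
  move: uD vD; rewrite !setDE !in_setI side_setC => /andP[uX us] /andP[vX vs].
  have := visible_same_side us vs neq_uv (visX u v uX vX).
  by rewrite negbK sX.
have [<-|neq_uv] := eqVneq u v; first exact: visible_refl.
have [uv|uv] := boolP (sedge u v); first exact: visible_adjacent.
move: (uv); rewrite sedge_side negbK => /eqP eq_side.
(* A vertex of the opposite side outside X is the middle of a path of length 2;
   it exists because X has the two vertices u, v besides that side. *)
have /subsetPn[w ws wX] : ~~ (side (~~ is_inl u) \subset X).
  apply/negP => sX; have := smallX _ sX; apply/negP; rewrite -ltnNge.
  have : (1 < #|X :\: side (~~ is_inl u)|)%N.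
    apply/card_gt1P; exists u, v.
    by rewrite !inE uX vX -eq_side; case: (is_inl u).
  by rewrite cardsDS //; lia.
move: ws; rewrite inE => /eqP ws.
apply: (visible_through uv neq_uv _ _ wX); rewrite sedge_side ws -?eq_side.
  by case: (is_inl u).
by case: (is_inl u).
Qed.

(** * Counting *)

Definition bad_sets s i : {set {set K}} :=
  [set X : {set K} | [&& (#|side s| + 2 <= i)%N, side s \subset X & #|X| == i]].

Lemma card_bad_sets s i :
  #|bad_sets s i| =
  if (#|side s| + 2 <= i)%N then 'C(#|side (~~ s)|, i - #|side s|) else 0%N.
Proof.
case: ifP => lesi; last by apply: eq_card0 => X; rewrite !inE lesi.
rewrite -side_setC -card_supersets; last by lia.
by apply: eq_card => X; rewrite !inE lesi.
Qed.

Lemma card_bad_setsI i : (1 < m)%N -> (1 < n)%N ->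
  #|bad_sets true i :&: bad_sets false i| = (i == (m + n)%N).
Proof.
move=> m1 n1; have [-> | neq_i] := eqVneq i (m + n)%N.
  rewrite -[RHS](cards1 [set: K]); apply: eq_card => X.
  rewrite !inE !card_side eqEcard subsetT cardsT card_vertices /=.
  apply/idP/idP => [|leX]; first by case/andP => /and3P[_ _ /eqP->].
  have -> : X = setT.
    by apply/eqP; rewrite eqEcard subsetT cardsT card_vertices.
  by rewrite !subsetT cardsT card_vertices eqxx; lia.
apply: eq_card0 => X; rewrite !inE; apply/negP.
case/andP => /and3P[_ sT /eqP cardX] /and3P[_ sF _].
case/eqP: neq_i; rewrite -cardX -card_vertices -cardsT; congr #|pred_of_set _|.
apply/eqP; rewrite eqEsubset subsetT -(setUCr (side true)) side_setC.
by rewrite subUset sT sF.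
Qed.

(** Inclusion-exclusion, written without subtraction; the term [i == m + n]
    accounts for the whole vertex set, which is bad for both sides. *)
Lemma num_mutual_visibilityE i : (1 < m)%N -> (1 < n)%N ->
  (num_mutual_visibility K i
   + ((if (m + 2 <= i)%N then 'C(n, i - m) else 0)
      + (if (n + 2 <= i)%N then 'C(m, i - n) else 0))
   = 'C(m + n, i) + (i == (m + n)%N))%N.
Proof.
move=> m1 n1.
have /= := card_bad_sets true i; rewrite !card_side => <-.
have /= := card_bad_sets false i; rewrite !card_side => <-.
rewrite -card_bad_setsI // -cardsUI addnA; congr (_ + _)%N.
rewrite -card_vertices -card_draws /num_mutual_visibility.
rewrite -[RHS](cardsID (bad_sets true i :|: bad_sets false i)) addnC.
congr (_ + _)%N; apply: eq_card => X; rewrite !inE.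
  by case: (#|X| == i); rewrite ?andbF ?andbT.
have [cardX|] := eqVneq #|X| i; last by rewrite !andbF.
rewrite !andbT; apply/asboolP/idP => [/mutual_visibilityP smallX | ].
  apply/negP => /orP[] /andP[lei sX]; have := smallX _ sX;
    by rewrite cardX; lia.
rewrite negb_or !negb_and => /andP[okT okF].
apply/mutual_visibilityP => s sX; rewrite cardX.
by case: s sX => sX; rewrite sX in okT okF; lia.
Qed.

End CompleteBipartite.

Theorem theorem14 (m n : nat) (hm : (3 <= m)%N) (hmn : (m <= n)%N) :
  visibility_poly (complete_bipartite m n) =
  \sum_(0 <= i < (m + n - 2).+1)
    (if (i <= m + 1)%N then 'C(m + n, i)%:Z
     else if (i <= n + 1)%N then 'C(m + n, i)%:Z - 'C(n, i - m)%:Z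
     else 'C(m + n, i)%:Z - 'C(n, i - m)%:Z - 'C(m, i - n)%:Z) *: 'X^i.
Proof.
have m1 : (1 < m)%N by lia.
have n1 : (1 < n)%N by lia.
rewrite /visibility_poly card_vertices.
rewrite (@big_cat_nat _ _ _ (m + n - 2).+1) /=; [|lia..].
rewrite [X in _ + X]big_nat_cond [X in _ + X]big1 ?addr0.
  apply: eq_big_nat => i lt_i; congr (_ *: _).
  have := num_mutual_visibilityE i m1 n1.
  have -> : (i == (m + n)%N) = false by lia.
  by do 2 case: ifP => ?; do ?case: ifP => ?; lia.
(* Only i = m + n - 1 and i = m + n remain. *)
move=> i; rewrite andbT => range_i.
have -> : num_mutual_visibility (complete_bipartite m n) i = 0%N; last first.
  by rewrite scale0r.
have := num_mutual_visibilityE i m1 n1; rewrite !ifT; [|lia..].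
have [-> | neq_i] := eqVneq i (m + n)%N.
  by rewrite addKn addnK !binn; lia.
have -> : i = (m + n).-1 by lia.
have -> : ((m + n).-1 - m = n.-1)%N by lia.
have -> : ((m + n).-1 - n = m.-1)%N by lia.
have binp k : (0 < k)%N -> 'C(k, k.-1) = k.
  by case: k => // k _; rewrite binSn.
by rewrite !binp; lia.
Qed.
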